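(* Let $\mathbb{R}^2=\mathrm{span}\{e_1,e_2\}$ denote the $2$-dimensional abelian Lie algebra and let $\omega=e^1\wedge e^2$ be the canonical symplectic form on $\mathbb{R}^2$, where $\{e^1,e^2\}$ is the dual basis. Then the only nonzero flat torsion-free connections $\nabla$ on $\mathbb{R}^2$ such that $\nabla\omega=0$ are the following: (a) $\nabla_{e_1}e_1=\alpha e_2$ ($\alpha\neq 0$), the other possibilities ($\nabla_{e_1}e_2$, $\nabla_{e_2}e_1$, $\nabla_{e_2}e_2$) being $0$; (b) $\nabla_{e_2}e_2=\alpha e_1$ ($\alpha\neq 0$), the other possibilities ($\nabla_{e_1}e_1$, $\nabla_{e_1}e_2$, $\nabla_{e_2}e_1$) being $0$; (c) for $\alpha\neq 0$, $\beta\neq 0$, $$\nabla_{e_1}e_1=\alpha e_1+\beta e_2,\qquad \nabla_{e_1}e_2=\nabla_{e_2}e_1=-\frac{\alpha}{\beta}(\alpha e_1+\beta e_2),\qquad \nabla_{e_2}e_2=\frac{\alpha^2}{\beta^2}(\alpha e_1+\beta e_2).$$ Here $\alpha,\beta\in\mathbb R$.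
   Context: A connection on a real Lie algebra $\mathfrak h$ is a bilinear map $\nabla:\mathfrak h\times\mathfrak h\to\mathfrak h$, $(x,y)\mapsto\nabla_xy$; it is torsion-free if $\nabla_xy-\nabla_yx=[x,y]$ and flat if $\nabla_x\nabla_y-\nabla_y\nabla_x=\nabla_{[x,y]}$ for all $x,y$. For a 2-form $\omega$ on $\mathfrak h$, $\nabla\omega=0$ means $\omega(\nabla_xy,z)=\omega(\nabla_xz,y)$ for all $x,y,z\in\mathfrak h$. *)

(* Defs.v *)
From HB Require Import structures.
From mathcomp Require Import all_boot all_order all_algebra.
From mathcomp Require Export sesquilinear.
From mathcomp Require Import reals ring.

Set Implicit Arguments.
Unset Strict Implicit.
Unset Printing Implicit Defensive.

Import GRing.Theory.
Local Open Scope ring_scope.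

Record lieAlgebra (K : fieldType) (h : lmodType K) := LieAlgebra {
  lie_bracket : {bilinear h -> h -> h};
  lie_alternating : forall x, lie_bracket x x = 0;
  lie_jacobi : forall x y z,
    lie_bracket x (lie_bracket y z) + lie_bracket y (lie_bracket z x)
      + lie_bracket z (lie_bracket x y) = 0
}.

Section Abelian.
Variables (K : fieldType) (h : lmodType K).

Definition zero_bracket (x y : h) : h := 0.

Lemma zero_bracket_bilinear : bilinear_for *:%R *:%R zero_bracket.
Proof. by split=> u k x y; rewrite /= /zero_bracket scaler0 addr0. Qed.

HB.instance Definition _ :=
  bilinear_isBilinear.Build K h h h *:%R *:%R zero_bracket zero_bracket_bilinear.

Lemma zero_bracket_alternating x : zero_bracket x x = 0.
Proof. by []. Qed.

Lemma zero_bracket_jacobi x y z :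
  zero_bracket x (zero_bracket y z) + zero_bracket y (zero_bracket z x)
    + zero_bracket z (zero_bracket x y) = 0.
Proof. by rewrite /zero_bracket !addr0. Qed.

Definition abelian_lie : lieAlgebra h :=
  @LieAlgebra K h zero_bracket zero_bracket_alternating zero_bracket_jacobi.

End Abelian.

(* A connection on h is a bilinear map, written (x, y) |-> nabla x y. *)
Section Connections.
Variables (K : fieldType) (h : lmodType K) (g : lieAlgebra h).
Implicit Type nabla : {bilinear h -> h -> h}.

Definition nonzero_connection nabla := exists x y, nabla x y <> 0.

Definition torsion_free nabla :=
  forall x y, nabla x y - nabla y x = lie_bracket g x y.

Definition flat nabla :=
  forall x y z,
    nabla x (nabla y z) - nabla y (nabla x z) = nabla (lie_bracket g x y) z.

(* For an alternating form omega this is nabla omega = 0, i.e.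
   omega (nabla x y) z + omega y (nabla x z) = 0. *)
Definition parallel (omega : {biscalar h}) nabla :=
  forall x y z, omega (nabla x y) z = omega (nabla x z) y.

End Connections.

Section Wedge.
Variables (K : fieldType) (h : lmodType K) (a b : {scalar h}).

Definition wedge (x y : h) : K := a x * b y - a y * b x.

Lemma wedge_bilinear : bilinear_for *%R *%R wedge.
Proof.
by split=> u k x y; rewrite /wedge !linearP /=; ring.
Qed.

HB.instance Definition _ :=
  bilinear_isBilinear.Build K h h K *%R *%R wedge wedge_bilinear.

Lemma wedge_alternating x : wedge x x = 0.
Proof. exact: subrr. Qed.

End Wedge.

Section Plane.
Variable R : realType.

Definition e1 : 'rV[R]_2 := delta_mx 0 0.
Definition e2 : 'rV[R]_2 := delta_mx 0 1.

Definition coord (i : 'I_2) (x : 'rV[R]_2) : R := x 0 i.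

Lemma coord_linear i : scalar (coord i).
Proof. by move=> k x y; rewrite /coord !mxE. Qed.

HB.instance Definition _ i :=
  GRing.isLinear.Build R 'rV[R]_2 R *%R (coord i) (coord_linear i).

Definition dual1 : {scalar 'rV[R]_2} := coord 0.
Definition dual2 : {scalar 'rV[R]_2} := coord 1.

Lemma dual_basisE :
  [/\ dual1 e1 = 1, dual1 e2 = 0, dual2 e1 = 0 & dual2 e2 = 1].
Proof. by split; rewrite /= /coord mxE. Qed.

Definition omega0 : {biscalar 'rV[R]_2} := wedge dual1 dual2.

End Plane.

Arguments e1 {R}.
Arguments e2 {R}.
Arguments omega0 {R}.

(* Main.v *)
Require Import Defs.
From mathcomp Require Import all_boot all_order all_algebra.
From mathcomp Require Import reals.
From mathcomp Require Import ring.
Import GRing.Theory.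
Local Open Scope ring_scope.

(** For a torsion-free connection on the plane, [nabla omega0 = 0] says that
    the trilinear form [omega0 (nabla x y) z] is totally symmetric, i.e. a
    binary cubic form.  Such a form has four coefficients [a, b, c, p], and
    the connection reads
      [nabla e1 e1 = (a, b)],  [nabla e1 e2 = nabla e2 e1 = (c, -a)],
      [nabla e2 e2 = (p, -c)]
    (lemma [symplectic_coefP]).  The curvature is then [omega0 x y] times a
    traceless endomorphism whose entries are, up to factors, the coefficients
      [a^2 + b c],  [a c + b p],  [a p - c^2]
    of the Hessian covariant of the cubic (lemma [curvatureE]).  Hence flatness
    is the vanishing of the Hessian, which characterises the cubes of linear
    forms (lemma [flat_coefP]).  Such a nonzero cube is determined by [a] and
    [b] if [b <> 0], since then [c = - a^2 / b] and [p = a^3 / b^2]: this gives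
    family (a) when [a = 0] and family (c) otherwise.  If [b = 0], then
    [a = c = 0] and only [p] survives, which is family (b). *)

Set Implicit Arguments.
Unset Strict Implicit.

Section PlaneConnections.
Variable R : realType.
Implicit Types (x y z : 'rV[R]_2) (a b c p : R).
Implicit Type nabla : {bilinear 'rV[R]_2 -> 'rV[R]_2 -> 'rV[R]_2}.

(** * Coordinates on the plane *)

Definition vec (u v : R) : 'rV[R]_2 := u *: e1 + v *: e2.

Lemma vec0E u v : vec u v 0 0 = u.
Proof. by rewrite !mxE /=; ring. Qed.

Lemma vec1E u v : vec u v 0 1 = v.
Proof. by rewrite !mxE /=; ring. Qed.

Lemma vec_coord x : x = vec (x 0 0) (x 0 1).
Proof.
apply/rowP => -[[|[|//]] lt_i].
  by rewrite (_ : Ordinal lt_i = 0) ?vec0E //; apply: val_inj.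
by rewrite (_ : Ordinal lt_i = 1) ?vec1E //; apply: val_inj.
Qed.

Lemma vec_inj u v u' v' : vec u v = vec u' v' -> u = u' /\ v = v'.
Proof. by move=> E; rewrite -(vec0E u v) -{2}(vec1E u v) E vec0E vec1E. Qed.

Lemma vecZ k u v : k *: vec u v = vec (k * u) (k * v).
Proof. by rewrite /vec scalerDr !scalerA. Qed.

Lemma vecD u v u' v' : vec u v + vec u' v' = vec (u + u') (v + v').
Proof. by rewrite /vec addrACA -!scalerDl. Qed.

Lemma vecN u v : - vec u v = vec (- u) (- v).
Proof. by rewrite -scaleN1r vecZ !mulN1r. Qed.

Lemma vec00 : vec 0 0 = 0.
Proof. by rewrite /vec !scale0r addr0. Qed.

Lemma e1E : e1 = vec 1 0.
Proof. by rewrite /vec scale1r scale0r addr0. Qed.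

Lemma e2E : e2 = vec 0 1.
Proof. by rewrite /vec scale1r scale0r add0r. Qed.

Lemma omega0_vec u v u' v' : omega0 (vec u v) (vec u' v') = u * v' - u' * v.
Proof.
have omega0E x y : omega0 x y = x 0 0 * y 0 1 - y 0 0 * x 0 1 by [].
by rewrite omega0E !vec0E !vec1E.
Qed.

Lemma nabla_vec nabla u v u' v' :
  nabla (vec u v) (vec u' v') =
  (u * u') *: nabla e1 e1 + (u * v') *: nabla e1 e2
  + ((v * u') *: nabla e2 e1 + (v * v') *: nabla e2 e2).
Proof.
by rewrite /vec linearDl !linearZl_LR /= !linearDr !linearZr_LR !scalerDr
  !scalerA.
Qed.

(** * Torsion-free connections preserving the area form *)

(** The connection attached to the cubic form [omega0 (nabla x x) x], which at
    [x = (s, t)] takes the value [- b s^3 + 3 a s^2 t + 3 c s t^2 + p t^3]. *)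
Definition has_coef nabla a b c p :=
  [/\ nabla e1 e1 = vec a b, nabla e1 e2 = vec c (- a),
      nabla e2 e1 = vec c (- a) & nabla e2 e2 = vec p (- c)].

Lemma coef_nabla_vec nabla a b c p u v u' v' :
  has_coef nabla a b c p ->
  nabla (vec u v) (vec u' v') =
  vec (u * u' * a + (u * v' + v * u') * c + v * v' * p)
      (u * u' * b - (u * v' + v * u') * a - v * v' * c).
Proof.
case=> E11 E12 E21 E22; rewrite nabla_vec E11 E12 E21 E22 !vecZ !vecD.
by congr vec; ring.
Qed.

(** Total symmetry of [omega0 (nabla x y) z] on basis vectors leaves exactly
    the four free coefficients of a binary cubic. *)
Lemma symplectic_coefP nabla :
  torsion_free (abelian_lie 'rV[R]_2) nabla /\ parallel omega0 nabla <->
  exists a b c p, has_coef nabla a b c p.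
Proof.
split=> [[tf par]|[a [b [c [p H]]]]]; last first.
  split=> [x y|x y z]; rewrite (vec_coord x) (vec_coord y).
    rewrite !(coef_nabla_vec _ _ _ _ H) vecN vecD.
    by rewrite [RHS](_ : _ = 0) // -vec00; congr vec; ring.
  rewrite (vec_coord z) !(coef_nabla_vec _ _ _ _ H) !omega0_vec.
  ring.
have E21 : nabla e2 e1 = nabla e1 e2 by apply/subr0_eq/tf.
pose u := nabla e1 e1; pose v := nabla e1 e2; pose w := nabla e2 e2.
have v1 : v 0 1 = - u 0 0.
  have := par e1 e1 e2; rewrite -/u -/v (vec_coord u) (vec_coord v) e1E e2E.
  by rewrite !omega0_vec !vec0E !vec1E => E; ring: E.
have w1 : w 0 1 = - v 0 0.
  have := par e2 e1 e2; rewrite E21 -/v -/w (vec_coord v) (vec_coord w) e1E e2E.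
  by rewrite !omega0_vec !vec0E !vec1E => E; ring: E.
exists (u 0 0), (u 0 1), (v 0 0), (w 0 0).
by split; rewrite ?E21 -?v1 -?w1 -vec_coord.
Qed.

(** * Curvature as the Hessian of the cubic *)

(** Each [nabla x] lies in sl(2), hence so does the commutator, which is
    alternating in [x, y] and thus proportional to [omega0 x y]. *)
Lemma curvatureE nabla a b c p x y z :
  has_coef nabla a b c p ->
  nabla x (nabla y z) - nabla y (nabla x z) =
  omega0 x y *:
    vec (2 * (a * p - c ^+ 2) * z 0 1 - (a * c + b * p) * z 0 0)
        (2 * (a ^+ 2 + b * c) * z 0 0 + (a * c + b * p) * z 0 1).
Proof.
move=> H; rewrite (vec_coord x) (vec_coord y) (vec_coord z).
rewrite !(coef_nabla_vec _ _ _ _ H) omega0_vec !vec0E !vec1E.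
by rewrite vecN vecD vecZ; congr vec; ring.
Qed.

Lemma flat_coefP nabla a b c p :
  has_coef nabla a b c p ->
  flat (abelian_lie 'rV[R]_2) nabla <->
  [/\ a ^+ 2 + b * c = 0, a * c + b * p = 0 & a * p - c ^+ 2 = 0].
Proof.
move=> H; split=> [fl|[E1 E2 E3] x y z]; last first.
  rewrite (curvatureE _ _ _ H) E1 E2 E3.
  rewrite /lie_bracket /= linear0l !(mulr0, mul0r) subr0 addr0 vec00.
  exact: scaler0.
have two_neq0 : 2 != 0 :> R by rewrite Num.Theory.pnatr_eq0.
(* As [omega0 e1 e2 = 1], curvature at [e1, e2] exhibits the Hessian itself. *)
have key z : vec (2 * (a * p - c ^+ 2) * z 0 1 - (a * c + b * p) * z 0 0)
        (2 * (a ^+ 2 + b * c) * z 0 0 + (a * c + b * p) * z 0 1) = vec 0 0.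
  have := fl e1 e2 z; rewrite (curvatureE _ _ _ H).
  rewrite {1}e1E {1}e2E omega0_vec mulr1 mulr0 subr0 scale1r => ->.
  by rewrite /lie_bracket /= linear0l vec00.
have [/eqP + /eqP] := vec_inj (key (vec 1 0)).
rewrite !vec0E !vec1E !mulr0 !mulr1 add0r addr0 oppr_eq0 => /eqP h.
rewrite mulf_eq0 (negPf two_neq0) /= => /eqP g.
have [/eqP + _] := vec_inj (key (vec 0 1)).
rewrite !vec0E !vec1E !mulr0 !mulr1 subr0 mulf_eq0 (negPf two_neq0) /=.
by move=> /eqP.
Qed.

Lemma nonzero_coefP nabla a b c p :
  has_coef nabla a b c p ->
  nonzero_connection nabla <-> ~ [/\ a = 0, b = 0, c = 0 & p = 0].
Proof.
move=> H; split=> [[x [y nz]] [a0 b0 c0 p0]|nz].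
  apply: nz; rewrite (vec_coord x) (vec_coord y).
  rewrite (coef_nabla_vec _ _ _ _ H) a0 b0 c0 p0 -vec00.
  by congr vec; ring.
have [E11 _ _ E22] := H.
have [ab0|ab] := eqVneq (nabla e1 e1) 0; last by exists e1, e1; apply/eqP.
exists e2, e2 => cp0; apply: nz.
move: ab0 cp0; rewrite E11 E22 -vec00 => /vec_inj[-> ->] /vec_inj[-> /eqP].
by rewrite oppr_eq0 => /eqP ->.
Qed.

(** * Binary cubics with vanishing Hessian *)

(** The cubes of linear forms, split by whether the linear form vanishes at
    [e1], where the cubic takes the value [- b]. *)
Lemma hessian0P a b c p :
  [/\ a ^+ 2 + b * c = 0, a * c + b * p = 0 & a * p - c ^+ 2 = 0] <->
  [/\ a = 0, b = 0 & c = 0] \/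
  [/\ b <> 0, c = - (a / b) * a & p = a ^+ 2 / b ^+ 2 * a].
Proof.
split=> [[E1 E2 E3]|[[-> -> ->]|[/eqP b0 -> ->]]]; last first.
- by split; field.
- by split; ring.
have [b0|b0] := eqVneq b 0; [left|right].
  move: E1 E3; rewrite b0 mul0r addr0 => /eqP.
  rewrite sqrf_eq0 => /eqP ->; rewrite mul0r sub0r => /eqP.
  by rewrite oppr_eq0 sqrf_eq0 => /eqP.
have Ec : c = - (a / b) * a.
  apply: (mulfI b0); rewrite (_ : b * (_ * a) = - a ^+ 2); last by field.
  by rewrite (addr0_eq E1).
split=> //; first exact/eqP.
apply: (mulfI b0); rewrite (_ : b * (_ * a) = - (a * c)).
  by rewrite (addr0_eq E2).
by rewrite Ec; field.
Qed.

End PlaneConnections.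

(** * The classification *)

Theorem theorem4p1 (R : realType)
    (nabla : {bilinear 'rV[R]_2 -> 'rV[R]_2 -> 'rV[R]_2}) :
  [/\ nonzero_connection nabla,
      flat (abelian_lie 'rV[R]_2) nabla,
      torsion_free (abelian_lie 'rV[R]_2) nabla
    & parallel omega0 nabla]
  <->
  [\/ (exists alpha : R, alpha <> 0 /\
        [/\ nabla e1 e1 = alpha *: e2, nabla e1 e2 = 0,
            nabla e2 e1 = 0 & nabla e2 e2 = 0]),
      (exists alpha : R, alpha <> 0 /\
        [/\ nabla e2 e2 = alpha *: e1, nabla e1 e1 = 0,
            nabla e1 e2 = 0 & nabla e2 e1 = 0])
    | (exists alpha beta : R, alpha <> 0 /\ beta <> 0 /\
        [/\ nabla e1 e1 = alpha *: e1 + beta *: e2,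
            nabla e1 e2 = - (alpha / beta) *: (alpha *: e1 + beta *: e2),
            nabla e2 e1 = - (alpha / beta) *: (alpha *: e1 + beta *: e2)
          & nabla e2 e2 =
              (alpha ^+ 2 / beta ^+ 2) *: (alpha *: e1 + beta *: e2)])].
Proof.
have coefP a b c p : has_coef nabla a b c p ->
    ~ [/\ a = 0, b = 0, c = 0 & p = 0] ->
    [/\ a = 0, b = 0 & c = 0] \/
      [/\ b <> 0, c = - (a / b) * a & p = a ^+ 2 / b ^+ 2 * a] ->
    [/\ nonzero_connection nabla, flat (abelian_lie 'rV[R]_2) nabla,
        torsion_free (abelian_lie 'rV[R]_2) nabla & parallel omega0 nabla].
  move=> H nz cube.
  have /symplectic_coefP[tf par] : exists a b c p, has_coef nabla a b c p.
    by exists a, b, c, p.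
  split=> //; first exact/(nonzero_coefP H).
  exact/(flat_coefP H)/hessian0P.
split=> [[nz fl tf par]|].
  have [a [b [c [p H]]]] := (symplectic_coefP nabla).1 (conj tf par).
  have {}nz := (nonzero_coefP H).1 nz.
  have [E11 E12 E21 E22] := H.
  have /hessian0P[[a0 b0 c0]|[b0 Ec Ep]] := (flat_coefP H).1 fl.
    apply: Or32; exists p; split; first by move=> p0; apply: nz.
    rewrite E11 E12 E21 E22 a0 b0 c0 oppr0 vec00.
    by split; rewrite // /vec scale0r addr0.
  have [a0|a0] := eqVneq a 0.
    apply: Or31; exists b; split=> //.
    rewrite E11 E12 E21 E22 Ep Ec a0 !mulr0 oppr0 vec00.
    by split; rewrite // /vec scale0r add0r.
  move/eqP: b0 => b0; apply: Or33; exists a, b.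
  split; first exact/eqP.
  split; first exact/eqP.
  rewrite -/(vec a b) !vecZ E11 E12 E21 E22 Ep Ec.
  by split=> //; congr vec; field.
case=> [[k [k0 [E11 E12 E21 E22]]]|[k [k0 [E22 E11 E12 E21]]]|].
- apply: (coefP 0 k 0 0); first 1 last.
  + by case.
  + by right; split=> //; rewrite mulr0.
  by split; rewrite ?E11 ?E12 ?E21 ?E22 ?oppr0 ?vec00 // /vec scale0r add0r.
- apply: (coefP 0 0 0 k); first 1 last.
  + by case.
  + by left.
  by split; rewrite ?E11 ?E12 ?E21 ?E22 ?oppr0 ?vec00 // /vec scale0r addr0.
case=> a [b [a0 [b0]]]; rewrite -/(vec a b) !vecZ => -[E11 E12 E21 E22].
apply: (coefP a b (- (a / b) * a) (a ^+ 2 / b ^+ 2 * a)); first 1 last.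
- by case.
- by right.
move/eqP: b0 => b0.
by split=> //; rewrite ?E12 ?E21 ?E22; congr vec; field.
Qed.
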